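(* Let $p$ be an odd prime and write $p-1=2^n z$ with $z$ odd. Let $g\in\mathcal{G}_S$ and $m'\in\mathcal{R}^{(n)}\setminus\mathcal{R}^{(n-1)}$ be fixed such that $g^z m'^{2z}= 1$ in $\mathbb{F}_p^*$. Define the sequence $(U_x)_{x\in\mathbb{N}}$ in $\mathbb{F}_p^*$ by $$U_0=g,\qquad U_{x+1}=(m'U_x)^2.$$ Then for all $x\in\mathbb{N}$, $U_x\in\mathcal{G}_S$ and $m'U_x\in\mathcal{G}_Z$. Moreover, if $0\leq x<y<\mathrm{logd}_2(1,z)$ then $U_x\neq U_y$, and $(U_x)$ is periodic of period $\mathrm{logd}_2(1,z)$.
   Context: $\mathbb{F}_p^*=(\mathbb{Z}/p\mathbb{Z})^\times$ and $\mathbb{N}$ contains $0$. $\mathcal{G}_Z$ is the set of primitive roots modulo $p$ (generators of $\mathbb{F}_p^*$). $\mathcal{G}_S$ is the set of semi-primitive roots modulo $p$, i.e. squares in $\mathbb{F}_p^*$ of primitive roots. The sets $\mathcal{R}^{(k)}\subset\mathbb{F}_p^*$ are defined recursively by $\mathcal{R}^{(0)}=\{1\}$ and $\mathcal{R}^{(k+1)}=\{x\in\mathbb{F}_p^* : x^2\in\mathcal{R}^{(k)}\}$. $\mathrm{logd}_2(1,z)$ is the multiplicative order of $2$ modulo $z$, i.e. the smallest positive integer $k$ such that $2^k\equiv 1\ [z]$. *)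

(* Defs.v *)
From mathcomp Require Import all_boot all_fingroup all_algebra all_solvable.

Set Implicit Arguments.
Unset Strict Implicit.
Unset Printing Implicit Defensive.

Local Open Scope group_scope.

(* F_p^* is the finite group {unit 'F_p}; for prime p, 'F_p is Z/pZ. *)

Definition primitive_roots (p : nat) : {set {unit 'F_p}} :=
  [set g | generator [set: {unit 'F_p}] g].

Definition semi_primitive_roots (p : nat) : {set {unit 'F_p}} :=
  [set g ^+ 2 | g in primitive_roots p].

Fixpoint iter_sqrt1 (p k : nat) : {set {unit 'F_p}} :=
  if k is k'.+1 then [set x | x ^+ 2 \in iter_sqrt1 p k'] else [set 1].

Lemma logd2_1_exists (z : nat) (oz : odd z) :
  exists k, (0 < k)%N && (2 ^ k == 1 %[mod z])%N.
Proof.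
exists (totient z); rewrite totient_gt0 odd_gt0 //=.
by apply/eqP/Euler_exp_totient; rewrite coprime2n.
Qed.

(* ex_minn returns the least witness, so this is the multiplicative order of 2
   modulo z; for z = 1 it is 1. *)
Definition logd2_1 (z : nat) (oz : odd z) : nat := ex_minn (logd2_1_exists oz).

(* Main.v *)
Require Import Defs.
From mathcomp Require Import all_boot all_fingroup all_algebra all_solvable.

(** Put V_x = U_x m'^2.  In the commutative group F_p^* the recursion for U
    becomes V_{x+1} = V_x^2, so that V_x = V_0^(2^x) ([shifted_orbit]) and
    U_x = V_0^(2^x) m'^-2.  Everything then follows from the orders of m' and of
    V_0 = g m'^2.

    The element m' has order 2^n, because it is killed by 2^n but not by
    2^(n-1).  The hypothesis g^z m'^(2z) = 1 says that V_0^z = 1, and since g is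
    the square of a generator the order of V_0 is exactly z
    ([order_odd_component]): V_0 is the odd part of g, and m'^-2 its 2-part.
    As z is odd, V_0^(2^x) still has order z, so m' U_x = V_0^(2^x) m'^-1 is the
    product of elements of coprime orders z and 2^n; its order is
    2^n z = p - 1, hence it is a primitive root, and U_{x+1} is its square.

    Finally U_x = U_y means V_0^(2^x) = V_0^(2^y), that is 2^x = 2^y modulo z,
    and 2 is invertible modulo z: the repetitions of U are governed by the
    multiplicative order of 2 modulo z. *)

Set Implicit Arguments.
Unset Strict Implicit.
Unset Printing Implicit Defensive.

Local Open Scope group_scope.

Lemma unit_Fp_commute (p : nat) (x y : {unit 'F_p}) : commute x y.
Proof. exact/val_inj/GRing.mulrC. Qed.

Lemma card_unit_Fp (p : nat) : prime p -> #|[set: {unit 'F_p}]| = (p - 1)%N.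
Proof. by move=> p_prime; rewrite card_finField_unit card_Fp // subn1. Qed.

Lemma primitive_rootsE (p : nat) (x : {unit 'F_p}) :
  prime p -> (x \in primitive_roots p) = (#[x] == p - 1)%N.
Proof.
move=> p_prime; rewrite inE /generator (eq_sym [set: _]) eqEcard subsetT /=.
by rewrite -(card_unit_Fp p_prime) orderE eqn_leq (subset_leq_card (subsetT _)).
Qed.

Lemma iter_sqrt1E (p k : nat) (x : {unit 'F_p}) :
  (x \in iter_sqrt1 p k) = (x ^+ (2 ^ k) == 1).
Proof.
by elim: k x => [|k IHk] x; rewrite inE ?expg1 // IHk -expgM expnS.
Qed.

Lemma order_pfactor (gT : finGroupType) (q n : nat) (x : gT) :
  prime q -> x ^+ (q ^ n) = 1 -> x ^+ (q ^ (n - 1)) != 1 -> #[x] = (q ^ n)%N.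
Proof.
move=> q_prime /eqP; rewrite -!order_dvdn.
move=> /(dvdn_pfactor _ _ q_prime)[k le_kn ->].
case: (ltngtP k n) le_kn => // [lt_kn _|-> //].
by rewrite dvdn_exp2l // subn1 -ltnS (ltn_predK lt_kn).
Qed.

Lemma order_expg_coprime (gT : finGroupType) (x : gT) (k : nat) :
  coprime #[x] k -> #[x ^+ k] = #[x].
Proof. by move=> /eqP co_xk; rewrite orderXgcd co_xk divn1. Qed.

(** If d is the order of h^2 m^2, then raising to the power 2^(n-1) d kills m^2
    as well as h^2 m^2, hence also h^2; so the order 2^n z of h divides 2^n d. *)
Lemma order_odd_component (gT : finGroupType) (n z : nat) (h m : gT) :
  commute h m -> (0 < n)%N -> #[h] = (2 ^ n * z)%N -> m ^+ (2 ^ n) = 1 ->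
  (h ^+ 2 * m ^+ 2) ^+ z = 1 -> #[h ^+ 2 * m ^+ 2] = z.
Proof.
move=> chm n_gt0 oh mn1 /eqP; rewrite -order_dvdn => dvd_z.
apply/eqP; rewrite eqn_dvd dvd_z /=.
rewrite -(@dvdn_pmul2l (2 ^ n)) ?expn_gt0 // -oh order_dvdn.
rewrite -expgMn //; set d := #[_].
have: (h * m) ^+ (2 ^ n * d) = 1.
  by rewrite -(prednK n_gt0) expnS -mulnA expgM mulnC expgM expg_order expg1n.
by rewrite expgMn // [m ^+ _]expgM mn1 expg1n mulg1 => ->.
Qed.

(** The shift by m^2 conjugates the map u |-> (m u)^2 to squaring. *)
Lemma shifted_orbit (gT : finGroupType) (m : gT) (U : nat -> gT) :
  (forall x y : gT, commute x y) -> (forall x, U x.+1 = (m * U x) ^+ 2) ->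
  forall x, U x * m ^+ 2 = (U 0%N * m ^+ 2) ^+ (2 ^ x).
Proof.
move=> comm US; elim=> [|x IHx]; first by rewrite expg1.
rewrite expnSr expgM -IHx US -expgMn // (comm m).
by rewrite -mulgA expgS expg1.
Qed.

Lemma eqn_mod_pow2 (z x y : nat) :
  odd z -> (x <= y)%N -> (2 ^ x == 2 ^ y %[mod z]) = (2 ^ (y - x) == 1 %[mod z]).
Proof.
move=> z_odd le_xy; rewrite eq_sym eqn_mod_dvd ?leq_exp2l //.
rewrite -{1}(subnKC le_xy) expnD -{2}[(2 ^ x)%N]muln1 -mulnBr.
by rewrite Gauss_dvdr ?coprimeXr ?coprimen2 // -eqn_mod_dvd ?expn_gt0.
Qed.

Lemma logd2_1P (z : nat) (z_odd : odd z) :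
  2 ^ logd2_1 z_odd = 1 %[mod z].
Proof. by rewrite /logd2_1; case: ex_minnP => k /andP[_ /eqP]. Qed.

Lemma logd2_1_min (z : nat) (z_odd : odd z) (k : nat) :
  (0 < k)%N -> (2 ^ k == 1 %[mod z])%N -> (logd2_1 z_odd <= k)%N.
Proof.
by rewrite /logd2_1; case: ex_minnP => l _ min_l k_gt0 ek; apply/min_l/andP.
Qed.

Theorem proposition2p2p10 (p n z : nat) (p_prime : prime p) (p_odd : odd p)
    (p_dec : (p - 1 = 2 ^ n * z)%N) (z_odd : odd z)
    (g m' : {unit 'F_p})
    (hg : g \in semi_primitive_roots p)
    (hm : m' \in iter_sqrt1 p n :\: iter_sqrt1 p (n - 1))
    (hgm : (g ^+ z * m' ^+ (2 * z) = 1)%g)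
    (U : nat -> {unit 'F_p})
    (U0 : U 0%N = g)
    (US : forall x : nat, U x.+1 = ((m' * U x) ^+ 2)%g) :
  (forall x : nat,
     U x \in semi_primitive_roots p /\ (m' * U x)%g \in primitive_roots p) /\
  (forall x y : nat, (x < y)%N -> (y < logd2_1 z_odd)%N -> U x <> U y) /\
  (forall x : nat, U (x + logd2_1 z_odd)%N = U x).
Proof.
have comm := @unit_Fp_commute p.
have n_gt0 : (0 < n)%N.
  case: n p_dec {hm} => // /(congr1 odd).
  by rewrite oddB ?(prime_gt0 p_prime) // p_odd mul1n z_odd.
move: hm; rewrite inE !iter_sqrt1E => /andP[m_n1 /eqP m_n].
have om : #[m'] = (2 ^ n)%N by apply: order_pfactor.
have oV : #[g * m' ^+ 2] = z.
  have [h h_prim def_g] := imsetP hg.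
  have oh : #[h] = (2 ^ n * z)%N.
    by apply/eqP; rewrite -p_dec -primitive_rootsE.
  rewrite def_g; apply: (order_odd_component (comm h m') n_gt0 oh m_n).
  by rewrite -def_g expgMn // -expgM.
have VE x : U x * m' ^+ 2 = (g * m' ^+ 2) ^+ (2 ^ x).
  by rewrite (shifted_orbit comm US) U0.
have eqU x y : (U x == U y) = (2 ^ x == 2 ^ y %[mod z]).
  by rewrite -(inj_eq (mulIg (m' ^+ 2))) !VE eq_expg_mod_order oV.
have prim x : m' * U x \in primitive_roots p.
  have -> : m' * U x = (g * m' ^+ 2) ^+ (2 ^ x) * m'^-1.
    by rewrite -VE expgS expg1 mulgA mulgK comm.
  have oVx : #[(g * m' ^+ 2) ^+ (2 ^ x)] = z.
    by rewrite order_expg_coprime oV // coprimeXr // coprimen2.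
  have co_Vm : coprime #[(g * m' ^+ 2) ^+ (2 ^ x)] #[m'^-1].
    by rewrite oVx orderV om coprimeXr // coprimen2.
  rewrite primitive_rootsE // (orderM (comm _ _) co_Vm).
  by rewrite oVx orderV om p_dec mulnC.
split; [move=> x; split=> // | split].
- by case: x => [|x]; rewrite ?U0 // US; apply/imset_f/prim.
- move=> x y lt_xy lt_yk /eqP; rewrite eqU eqn_mod_pow2 1?ltnW //.
  move/(logd2_1_min z_odd); rewrite subn_gt0 lt_xy => /(_ isT).
  by apply/negP; rewrite -ltnNge (leq_ltn_trans (leq_subr x y)).
move=> x; apply/eqP; rewrite eq_sym eqU eqn_mod_pow2 ?leq_addr // addKn.
exact/eqP/logd2_1P.
Qed.
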